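(* For every $\alpha\in[0,1)$ there is a constant $c_\alpha>0$ such that for any finite group $G$, any $f\in\mathbb{C}[G]$ with $1_G\succeq f\succeq\alpha 1_G$, and any positive integer $d$, $$\varrho_d\le\begin{cases}\dfrac{c_\alpha}{d}\left(\dfrac{1-\alpha^2}{1+\alpha^2}\right)^{2d} & \text{if } 0<\alpha<1,\\[2mm] \dfrac{c_\alpha}{d^2} & \text{if }\alpha=0,\end{cases}$$ where $$\varrho_d:=\min\Big\{\sum_{x\in G}|C_{f-f_Q}(x)|^2:\ Q\in\mathbb{C}^{S_d\times S_d},\ Q=Q^{\mathsf H},\ Q\succeq0\Big\}.$$
   Context: For a finite group $G$ with identity $1_G$, every $f\in\mathbb{C}[G]$ is written $f=\sum_{x\in G}C_f(x)x$ with $C_f:G\to\mathbb{C}$; $f^*=\sum_{x}\overline{C_f(x)}x^{-1}$; $\operatorname{supp}(f)=\{x\in G:C_f(x)\ne0\}$. A $*$-representation of $\mathbb{C}[G]$ is an algebra homomorphism $\pi:\mathbb{C}[G]\to\mathbb{C}^{n\times n}$ with $\pi(x)$ unitary for $x\in G$ and $\pi(f^* )=\pi(f)^{\mathsf H}$ (conjugate transpose). The notation $1_G\succeq f\succeq\alpha1_G$ means that $f=f^*$ and, for every $*$-representation $\pi$, all eigenvalues of the Hermitian matrix $\pi(f)$ lie in $[\alpha,1]$. For $k\ge 0$ let $p_{\alpha,k}$ be the real univariate polynomial of degree at most $k$ that is the best uniform approximation of $\sqrt t$ on $[\alpha,1]$, i.e. the minimizer of $\max_{t\in[\alpha,1]}|p(t)-\sqrt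 t|$ over real polynomials $p$ of degree at most $k$. For $f\in\mathbb{C}[G]$ with $1_G\succeq f\succeq\alpha1_G$, $p_{\alpha,k}(f)\in\mathbb{C}[G]$ is obtained by evaluating the polynomial at $f$ (the constant term being multiplied by $1_G$), and $S_d:=\bigcup_{0\le k\le d}\operatorname{supp}(p_{\alpha,k}(f))\subseteq G$. For $Q\in\mathbb{C}^{S_d\times S_d}$ (a matrix with rows and columns indexed by $S_d$), $f_Q:=\sum_{x,y\in S_d}Q(x,y)\,x^{-1}y\in\mathbb{C}[G]$. *)

(* Defs.v *)
From HB Require Import structures.
From mathcomp Require Import all_boot all_order all_algebra all_fingroup.
From mathcomp Require Import complex.
From mathcomp Require Import boolp classical_sets reals set_interval.

Set Implicit Arguments.
Unset Strict Implicit.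
Unset Printing Implicit Defensive.
Import Order.TTheory GRing.Theory Num.Theory.
Local Open Scope ring_scope.
Local Open Scope sesquilinear_scope.
Local Open Scope complex_scope.

(* The group algebra A[gT]. It is a wrapper around {ffun gT -> A}, not an
   alias, because {ffun gT -> A} already carries the pointwise product. *)
Record galg (A : Type) (gT : finGroupType) := GAlg { gcoef : {ffun gT -> A} }.
Arguments GAlg {A gT}.

HB.instance Definition _ (A : Type) (gT : finGroupType) :=
  [isNew for @gcoef A gT].
HB.instance Definition _ (A : eqType) (gT : finGroupType) :=
  [Equality of galg A gT by <:].
HB.instance Definition _ (A : choiceType) (gT : finGroupType) :=
  [Choice of galg A gT by <:].

Section GroupAlgebra.
Variables (A : comNzRingType) (gT : finGroupType).
Implicit Types (f g h : galg A gT) (x y : gT) (a b : A).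

Definition galg_of_fun (F : gT -> A) : galg A gT := GAlg (finfun F).

Lemma galg_of_funE F x : gcoef (galg_of_fun F) x = F x.
Proof. by rewrite ffunE. Qed.

Lemma galgP f g : gcoef f =1 gcoef g <-> f = g.
Proof. by split=> [e|->//]; apply/val_inj/ffunP. Qed.

Definition galg_elt x := galg_of_fun (fun y => (y == x)%:R).

Definition galg_zero := galg_of_fun (fun=> 0).
Definition galg_opp f := galg_of_fun (fun x => - gcoef f x).
Definition galg_add f g := galg_of_fun (fun x => gcoef f x + gcoef g x).

Fact galg_addA : associative galg_add.
Proof. by move=> f g h; apply/galgP => x; rewrite !galg_of_funE addrA. Qed.
Fact galg_addC : commutative galg_add.
Proof. by move=> f g; apply/galgP => x; rewrite !galg_of_funE addrC. Qed.
Fact galg_add0 : left_id galg_zero galg_add.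
Proof. by move=> f; apply/galgP => x; rewrite !galg_of_funE add0r. Qed.
Fact galg_addN : left_inverse galg_zero galg_opp galg_add.
Proof. by move=> f; apply/galgP => x; rewrite !galg_of_funE addNr. Qed.

HB.instance Definition _ := GRing.isZmodule.Build (galg A gT)
  galg_addA galg_addC galg_add0 galg_addN.

Lemma gcoef0 x : gcoef (0 : galg A gT) x = 0.
Proof. exact: galg_of_funE. Qed.
Lemma gcoefD f g x : gcoef (f + g) x = gcoef f x + gcoef g x.
Proof. exact: galg_of_funE. Qed.
Lemma gcoefN f x : gcoef (- f) x = - gcoef f x.
Proof. exact: galg_of_funE. Qed.
Lemma gcoefB f g x : gcoef (f - g) x = gcoef f x - gcoef g x.
Proof. by rewrite gcoefD gcoefN. Qed.

Definition galg_mul f g :=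
  galg_of_fun (fun x => \sum_y gcoef f y * gcoef g (y^-1 * x)%g).

Fact galg_mulA : associative galg_mul.
Proof.
move=> f g h; apply/galgP => x; rewrite !galg_of_funE.
under eq_bigr do rewrite galg_of_funE mulr_sumr.
under [RHS]eq_bigr do rewrite galg_of_funE mulr_suml.
rewrite [RHS]exchange_big /=; apply: eq_bigr => y _.
rewrite [RHS](reindex_inj (mulgI y)) /=; apply: eq_bigr => z _.
by rewrite mulrA mulKg invMg mulgA.
Qed.

Fact galg_mul1 : left_id (galg_elt 1%g) galg_mul.
Proof.
move=> f; apply/galgP => x; rewrite galg_of_funE (bigD1 1%g) //=.
rewrite galg_of_funE eqxx mul1r invg1 mul1g big1 ?addr0 // => y /negPf ny.
by rewrite galg_of_funE ny mul0r.
Qed.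

Fact galg_mulr1 : right_id (galg_elt 1%g) galg_mul.
Proof.
move=> f; apply/galgP => x; rewrite galg_of_funE (bigD1 x) //=.
rewrite galg_of_funE mulVg eqxx mulr1 big1 ?addr0 // => y ny.
rewrite galg_of_funE -(inj_eq (mulgI y)) mulKVg mulg1 eq_sym (negPf ny).
by rewrite mulr0.
Qed.

Fact galg_mulDl : left_distributive galg_mul +%R.
Proof.
move=> f g h; apply/galgP => x; rewrite gcoefD !galg_of_funE -big_split /=.
by apply: eq_bigr => y _; rewrite gcoefD mulrDl.
Qed.

Fact galg_mulDr : right_distributive galg_mul +%R.
Proof.
move=> f g h; apply/galgP => x; rewrite gcoefD !galg_of_funE -big_split /=.
by apply: eq_bigr => y _; rewrite gcoefD mulrDr.
Qed.

Fact galg_oner_neq0 : galg_elt 1%g != 0.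
Proof.
apply/eqP => /galgP /(_ 1%g); rewrite gcoef0 galg_of_funE eqxx.
by apply/eqP/oner_neq0.
Qed.

HB.instance Definition _ := GRing.Zmodule_isNzRing.Build (galg A gT)
  galg_mulA galg_mul1 galg_mulr1 galg_mulDl galg_mulDr galg_oner_neq0.

Lemma gcoef1 x : gcoef (1 : galg A gT) x = (x == 1%g)%:R.
Proof. exact: galg_of_funE. Qed.
Lemma gcoefM f g x :
  gcoef (f * g) x = \sum_y gcoef f y * gcoef g (y^-1 * x)%g.
Proof. exact: galg_of_funE. Qed.

Definition galg_scale a f := galg_of_fun (fun x => a * gcoef f x).

Fact galg_scaleA a b f :
  galg_scale a (galg_scale b f) = galg_scale (a * b) f.
Proof. by apply/galgP => x; rewrite !galg_of_funE mulrA. Qed.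
Fact galg_scale1 : left_id 1 galg_scale.
Proof. by move=> f; apply/galgP => x; rewrite galg_of_funE mul1r. Qed.
Fact galg_scaleDr : right_distributive galg_scale +%R.
Proof.
move=> a f g; apply/galgP => x; rewrite galg_of_funE !gcoefD !galg_of_funE.
by rewrite mulrDr.
Qed.
Fact galg_scaleDl f : {morph galg_scale^~ f : a b / a + b}.
Proof.
by move=> a b; apply/galgP => x; rewrite gcoefD !galg_of_funE mulrDl.
Qed.

HB.instance Definition _ := GRing.Zmodule_isLmodule.Build A (galg A gT)
  galg_scaleA galg_scale1 galg_scaleDr galg_scaleDl.

Lemma gcoefZ a f x : gcoef (a *: f) x = a * gcoef f x.
Proof. exact: galg_of_funE. Qed.

Fact galg_scaleAl a f g : a *: (f * g) = (a *: f) * g.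
Proof.
apply/galgP => x; rewrite gcoefZ !gcoefM mulr_sumr.
by apply: eq_bigr => y _; rewrite gcoefZ mulrA.
Qed.
HB.instance Definition _ :=
  GRing.Lmodule_isLalgebra.Build A (galg A gT) galg_scaleAl.

Fact galg_scaleAr a f g : a *: (f * g) = f * (a *: g).
Proof.
apply/galgP => x; rewrite gcoefZ !gcoefM mulr_sumr.
by apply: eq_bigr => y _; rewrite gcoefZ mulrCA.
Qed.
HB.instance Definition _ :=
  GRing.Lalgebra_isAlgebra.Build A (galg A gT) galg_scaleAr.

Definition gsupp f : {set gT} := [set x | gcoef f x != 0]%SET.

End GroupAlgebra.

Section Statement.
Variable R : realType.
Local Notation C := R[i].

Definition galg_star (gT : finGroupType) (f : galg C gT) : galg C gT :=
  galg_of_fun (fun x => (gcoef f x^-1%g)^*%R).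

(* {lrmorphism _} also asks for pi 1 = 1; this is no restriction, since a
   multiplicative pi with pi (galg_elt 1) unitary satisfies it. *)
Definition star_representation (gT : finGroupType) (n : nat)
    (pi : {lrmorphism galg C gT -> 'M[C]_n}) : Prop :=
  (forall x : gT, pi (galg_elt C x) \is unitarymx) /\
  (forall f : galg C gT, pi (galg_star f) = (pi f)^t*).

(* The order of R[i] only compares numbers with equal imaginary parts, so the
   last line says that a is real and lies in [alpha, 1]. *)
Definition spectrum_in (gT : finGroupType) (alpha : R) (f : galg C gT) : Prop :=
  f = galg_star f /\
  forall (n : nat) (pi : {lrmorphism galg C gT -> 'M[C]_n}),
    star_representation pi ->
    forall a : C, eigenvalue (pi f) a -> alpha%:C <= a <= 1.

Definition sqrt_dist (alpha : R) (p : {poly R}) : R :=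
  sup [set `|p.[t] - Num.sqrt t| | t in `[alpha, 1]%classic]%classic.

Definition is_best_sqrt_approx (alpha : R) (k : nat) (p : {poly R}) : Prop :=
  (size p <= k.+1)%N /\
  forall q : {poly R}, (size q <= k.+1)%N -> sqrt_dist alpha p <= sqrt_dist alpha q.

(* For alpha in [0, 1) there is exactly one best approximation (Chebyshev),
   hence the default value 0 is not used. *)
Definition best_sqrt_approx (alpha : R) (k : nat) : {poly R} :=
  xget 0 [set p | is_best_sqrt_approx alpha k p]%classic.

Definition galg_eval (gT : finGroupType) (p : {poly R}) (f : galg C gT) :
    galg C gT :=
  horner_alg f (map_poly (real_complex R) p).

Definition approx_supp (gT : finGroupType) (alpha : R) (f : galg C gT)
    (d : nat) : {set gT} :=
  (\bigcup_(k < d.+1) gsupp (galg_eval (best_sqrt_approx alpha k) f))%SET.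

Definition psdmx (n : nat) (Q : 'M[C]_n) : Prop :=
  Q \is hermsymmx /\ forall v : 'cV[C]_n, 0 <= (v^t* *m Q *m v) 0 0.

(* Rows and columns of Q are indexed by S through enum_val : 'I_#|S| -> gT. *)
Definition galg_gram (gT : finGroupType) (S : {set gT}) (Q : 'M[C]_#|S|) :
    galg C gT :=
  \sum_i \sum_j Q i j *: galg_elt C ((enum_val i)^-1 * enum_val j)%g.

Definition sq_l2norm (gT : finGroupType) (h : galg C gT) : R :=
  \sum_x Normc.normc (gcoef h x) ^+ 2.

Definition sos_errors (gT : finGroupType) (alpha : R) (f : galg C gT)
    (d : nat) : set R :=
  [set sq_l2norm (f - galg_gram Q) |
    Q in [set Q : 'M[C]_#|approx_supp alpha f d| | psdmx Q]]%classic.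

Definition is_min (E : set R) (m : R) : Prop := E m /\ lbound E m.

End Statement.

(* Main.v *)
From HB Require Import structures.
Require Import Defs.
From mathcomp Require Import all_boot all_order all_algebra all_fingroup.
From mathcomp Require Import complex.
From mathcomp Require Import boolp classical_sets reals.
From mathcomp Require Import topology normedtype derive realfun.
From mathcomp Require Import ring lra.

(** Let p be a best approximation of the square root on [alpha, 1] of degree at
    most d.  Since p is real and f = f^*, the element h = p(f) is self-adjoint,
    so p(f)^2 = h^* h is the Gram element of the rank-one matrix with entries
    conj(h_x) h_y, whose rows and columns may be restricted to S_d because S_d
    contains the support of h ([gram_rank1]).  Hence rho_d is at most the
    squared coefficient norm of f - p(f)^2.

    The coefficients of an element g are the entries of one column of its image
    under the regular representation.  For g = q(f) that image is unitarily
    diagonalisable with diagonal entries q(t), t in [alpha, 1], so the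
    coefficient norm of q(f) is at most the supremum of |q| on [alpha, 1]
    ([sq_l2norm_eval_le]).  For q = t - p^2 and e = sup |p - sqrt t| this gives
    rho_d <= (e (2 + e))^2, and as p is a best approximation, e may be replaced
    by the error of any polynomial of degree at most d ([sos_error_le]).

    It remains to exhibit good enough polynomials.
    - For alpha > 0 the Taylor polynomial at 1 has error at most
      d alpha^-2 (1 - alpha)^d ([sqrt_taylor_error]).  This is not the optimal
      rate, but 1 - alpha < (1 - alpha^2) / (1 + alpha^2), and the geometric gap
      absorbs every power of d ([taylor_rate]).
    - For alpha = 0 the Taylor error decays only like d^(-1/2).  Substitute
      t = u^2, so that the function to approximate is |u|, and approximate it by
      u P(u) / P(1), where P is the primitive of a Fejer kernel concentrated
      at 0.  This is an even polynomial in u with error O(1/d)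
      ([sqrt_fejer_error]).

    Both the best approximation and the minimum defining rho_d exist by
    compactness: each is the minimum of a function on a finite-dimensional
    space whose sublevel sets are closed and bounded ([ptws_attains_min]). *)

Set Implicit Arguments.
Unset Strict Implicit.
Unset Printing Implicit Defensive.
Import Order.TTheory GRing.Theory Num.Theory.
Import numFieldNormedType.Exports.
Local Open Scope ring_scope.

(** * Attained minima *)

Section AttainedMin.
Variable R : realType.
Local Open Scope classical_set_scope.

(** A minimiser is a point common to all sublevel sets {F <= F y}.  These sets
    are nested, so they form a filter base, and a cluster point of that filter
    lies in all of them because they are closed.  Closed sublevel sets are what
    a supremum of continuous functions has. *)
Lemma lsc_attains_min (T : topologicalType) (A : set T) (F : T -> R) :
  A !=set0 ->
  (forall m, closed (A `&` [set x | F x <= m])) ->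
  (forall m, compact (A `&` [set x | F x <= m])) ->
  exists2 x, A x & forall y, A y -> F x <= F y.
Proof.
move=> [x0 Ax0] cl co; pose S m := A `&` [set x | F x <= m].
pose G : set_system T := [set U | exists2 y, A y & S (F y) `<=` U].
have GF : ProperFilter G.
  split; first by case=> y Ay /(_ y); apply; split=> /=.
  split=> [|U V [y Ay yU] [z Az zV]|U V UV [y Ay yU]].
  - by exists x0.
  - have [yz|/ltW zy] := leP (F y) (F z).
      exists y => // x [Ax xy]; split; first exact: yU.
      by apply: zV; split=> //=; exact: le_trans yz.
    exists z => // x [Ax xz]; split; last exact: zV.
    by apply: yU; split=> //=; exact: le_trans zy.
  - by exists y => //; exact: subset_trans UV.
have [|p [[Ap _] clp]] := co (F x0) G GF; first by exists x0.
exists p => // y Ay; suff [] : S (F y) p by [].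
by apply: cl => B pB; apply: clp => //; exists y.
Qed.

Lemma closed_box_compact (I : eqType) (B : set {ptws I -> R}) (r : R) :
  closed B -> (forall u, B u -> forall i, `|u i| <= r) -> compact B.
Proof.
move=> clB Br.
pose box := [set u : {ptws I -> R} | forall i, `[- r, r] (u i)].
apply: (@subclosed_compact _ _ box) => //.
  exact: (@tychonoff I (fun=> R) (fun=> `[- r, r])
            (fun=> @segment_compact R _ _)).
by move=> u Bu i; rewrite /= in_itv /= -ler_norml; exact: Br.
Qed.

(** In a product of real lines with the pointwise topology, boxes are compact by
    Tychonoff, so bounds on the coordinates of each sublevel set suffice. *)
Lemma ptws_attains_min (I : eqType) (A : set {ptws I -> R})
    (F : {ptws I -> R} -> R) :
  A !=set0 ->
  (forall m, closed (A `&` [set u | F u <= m])) ->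
  (forall m, exists r, forall u, A u -> F u <= m -> forall i, `|u i| <= r) ->
  exists2 u, A u & forall v, A v -> F u <= F v.
Proof.
move=> A0 cl bd; apply: lsc_attains_min => // m; have [r ur] := bd m.
by apply: closed_box_compact (cl m) _ => u [Au um]; exact: ur.
Qed.

Lemma continuous_coord (I : eqType) (i : I) :
  continuous (fun u : {ptws I -> R} => u i).
Proof. exact: (@proj_continuous I (fun=> R) i). Qed.

Lemma continuous_big_sum (T : topologicalType) (J : Type) (s : seq J)
  (f : J -> T -> R) : (forall j, continuous (f j)) ->
  continuous (fun x => \sum_(j <- s) f j x).
Proof.
move=> fc; elim: s => [|j s IH] x.
  under eq_fun do rewrite big_nil; exact: cst_continuous.
under eq_fun do rewrite big_cons.
by apply: continuousD; [exact: fc | exact: IH].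
Qed.

Lemma continuous_mul (T : topologicalType) (f g : T -> R) :
  continuous f -> continuous g -> continuous (fun x => f x * g x).
Proof. by move=> cf cg x; exact: (continuousM (cf x) (cg x)). Qed.

Lemma closed_le_fun (T : topologicalType) (f : T -> R) (m : R) :
  continuous f -> closed [set x | f x <= m].
Proof.
move=> fc; apply: (@preimage_closed _ _ f [set y | y <= m]).
  by move=> x _; exact: fc.
exact: closed_le.
Qed.

Lemma closed_ge_fun (T : topologicalType) (f : T -> R) (m : R) :
  continuous f -> closed [set x | m <= f x].
Proof.
move=> fc; apply: (@preimage_closed _ _ f [set y | m <= y]).
  by move=> x _; exact: fc.
exact: closed_ge.
Qed.

Lemma closed_eq_fun (T : topologicalType) (f : T -> R) (m : R) :
  continuous f -> closed [set x | f x = m].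
Proof.
move=> fc; apply: (@preimage_closed _ _ f [set y | y = m]).
  by move=> x _; exact: fc.
exact: closed_eq.
Qed.

End AttainedMin.

(** * Best uniform approximation of the square root *)

Section BestApprox.
Variable R : realType.
Implicit Types (p q : {poly R}) (a t e : R).
Local Open Scope classical_set_scope.

Lemma poly_bounded01 p : exists M, forall t, 0 <= t <= 1 -> `|p.[t]| <= M.
Proof.
exists (\sum_(i < size p) `|p`_i|) => t /andP[t0 t1].
rewrite horner_coef (le_trans (ler_norm_sum _ _ _))// ler_sum// => i _.
by rewrite normrM ler_piMr// ger0_norm ?exprn_ge0// exprn_ile1.
Qed.

Section Dist.
Variables (a : R).
Hypothesis a01 : 0 <= a < 1.

Lemma sqrt_dist_has_sup p :
  has_sup [set `|p.[t] - Num.sqrt t| | t in `[a, 1]].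
Proof.
have /andP[a0 a1] := a01; split.
  by exists `|p.[1] - Num.sqrt 1|; exists 1 => //=; rewrite in_itv /= lexx ltW.
have [M pM] := poly_bounded01 p; exists (M + 1) => _ /= [t + <-].
rewrite in_itv /= => /andP[at_ t1]; have t0 := le_trans a0 at_.
rewrite (le_trans (ler_normB _ _))// lerD ?pM ?t0//.
by rewrite ger0_norm ?sqrtr_ge0// -sqrtr1 ler_wsqrtr.
Qed.

Lemma sqrt_dist_ge p t : a <= t <= 1 -> `|p.[t] - Num.sqrt t| <= sqrt_dist a p.
Proof.
move=> t01; apply: ub_le_sup; first by case: (sqrt_dist_has_sup p).
by exists t => //=; rewrite in_itv.
Qed.

(** The supremum defining [sqrt_dist] is finite, so it may be handled
    pointwise. *)
Lemma sqrt_dist_le p e :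
  (forall t, a <= t <= 1 -> `|p.[t] - Num.sqrt t| <= e) <-> sqrt_dist a p <= e.
Proof.
split=> [pe|de t t01]; last exact: le_trans (sqrt_dist_ge p t01) de.
apply: ge_sup; first by case: (sqrt_dist_has_sup p).
by move=> _ /= [t + <-]; rewrite in_itv /= => /pe.
Qed.

Definition node (i : nat) : R := a + (1 - a) / i.+1%:R.

Lemma node_inj : injective node.
Proof.
have /andP[a0 a1] := a01.
have n0 (i : nat) : i.+1%:R != 0 :> R by rewrite pnatr_eq0.
move=> i j /addrI /mulfI; rewrite subr_eq0 gt_eqF// => /(_ isT) /invr_inj.
by move=> /eqP; rewrite eqr_nat eqSS => /eqP.
Qed.

Lemma node_in i : a <= node i <= 1.
Proof.
have /andP[a0 a1] := a01; have a1' : 0 <= 1 - a by rewrite subr_ge0 ltW.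
rewrite lerDl divr_ge0//= -lerBrDl ler_pdivrMr ?ltr0Sn//.
by rewrite ler_peMr// ler1n.
Qed.

(** A polynomial of degree at most k is parametrised by its values at k+1 nodes
    of [a, 1].  With these coordinates a bound on the distance to the square
    root immediately bounds every coordinate, and the distance is a supremum of
    continuous functions of the coordinates. *)
Lemma best_sqrt_approx_exists k : exists p, is_best_sqrt_approx a k p.
Proof.
pose l (i : 'I_k.+1) : {poly R} := tnth (lagrange k.+1 node) i.
pose L (u : {ptws 'I_k.+1 -> R}) : {poly R} := \sum_i u i *: l i.
have LE u t : (L u).[t] = \sum_i u i * (l i).[t].
  by rewrite horner_sum; apply: eq_bigr => i _; rewrite hornerZ.
have Lc t : continuous (fun u : {ptws 'I_k.+1 -> R} => (L u).[t]).
  have -> : (fun u : {ptws 'I_k.+1 -> R} => (L u).[t]) =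
      (fun u => \sum_i u i * (l i).[t]) by apply/funext => u; exact: LE.
  apply: continuous_big_sum => i.
  apply: (continuous_mul (@continuous_coord R _ i)); exact: cst_continuous.
have Lnode u (i : 'I_k.+1) : (L u).[node i] = u i.
  rewrite LE (bigD1 i)//= big1 => [|j ji].
    by rewrite addr0 /l lagrange_sample ?eqxx ?mulr1//; exact: node_inj.
  by rewrite /l lagrange_sample ?(negPf ji) ?mulr0//; exact: node_inj.
have sL u : (size (L u) <= k.+1)%N.
  apply: leq_trans (size_sum _ _ _) _; apply/bigmax_leqP => i _.
  apply: leq_trans (size_scale_leq _ _) _.
  by rewrite /l size_lagrange_//; exact: node_inj.
have LK q : (size q <= k.+1)%N -> q = L (fun i => q.[node i]).
  move=> sq; rewrite [LHS](lagrange_gen _ node_inj sq)//.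
  by apply: eq_bigr => i _; rewrite mul_polyC.
have [|m|m|u _ umin] := @ptws_attains_min R _ setT (fun u => sqrt_dist a (L u)).
- by exists (fun=> 0).
- rewrite setTI.
  have -> : [set u | sqrt_dist a (L u) <= m] =
      \bigcap_(t in [set t | a <= t <= 1])
        [set u | `|(L u).[t] - Num.sqrt t| <= m].
    by apply/seteqP; split => u /= /sqrt_dist_le.
  apply: closed_bigI => t _; apply: closed_le_fun => u.
  apply: (@continuous_comp _ _ _ (fun u => (L u).[t] - Num.sqrt t)
            (fun x => `|x|)).
    apply: continuousB; last exact: cst_continuous.
    exact: Lc.
  exact: norm_continuous.
- exists (m + 1) => u _ um i.
  rewrite -[u i](Lnode u) -[(L u).[_]](subrK (Num.sqrt (node i))).
  rewrite (le_trans (ler_normD _ _))// lerD//.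
    by apply: le_trans um; exact/sqrt_dist_ge/node_in.
  rewrite ger0_norm ?sqrtr_ge0// -sqrtr1 ler_wsqrtr//.
  by have /andP[] := node_in i.
- exists (L u); split=> // q /LK ->; exact: umin.
Qed.

Lemma best_sqrt_approxP k : is_best_sqrt_approx a k (best_sqrt_approx a k).
Proof.
have ex := best_sqrt_approx_exists k.
exact: (@xgetPex _ 0 [set p | is_best_sqrt_approx a k p] ex).
Qed.

End Dist.
End BestApprox.

(** * Taylor polynomials of the square root at 1 *)

Section Taylor.
Variable R : realType.
Implicit Types (t a : R) (d n : nat).

(** The binomial coefficient (1/2 choose n) up to the sign (-1)^n, so that
    sqrt t is the sum of [sqrt_coef n] (1 - t)^n. *)
Fixpoint sqrt_coef n : R :=
  if n is m.+1 then sqrt_coef m * (m%:R - 2^-1) / m.+1%:R else 1.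

Lemma sqrt_coef_le1 n : `|sqrt_coef n| <= 1.
Proof.
elim: n => [|n IH] /=; first by rewrite normr1.
have n0 : 0 <= n%:R :> R by exact: ler0n.
rewrite -mulrA normrM -[leRHS]mulr1 ler_pM ?normr_ge0// normrM.
rewrite normfV (gtr0_norm (ltr0Sn _ _)) ler_pdivrMr ?ltr0Sn// mul1r.
rewrite -[n.+1%:R]natr1.
by rewrite ler_norml; apply/andP; split; lra.
Qed.

Definition sqrt_taylor d : {poly R} :=
  \sum_(n < d.+1) sqrt_coef n *: (1 - 'X) ^+ n.

Lemma size_sqrt_taylor d : (size (sqrt_taylor d) <= d.+1)%N.
Proof.
apply: leq_trans (size_sum _ _ _) _; apply/bigmax_leqP => -[n /= nd] _.
apply: leq_trans (size_scale_leq _ _) _.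
apply: leq_trans (size_poly_exp_leq _ _) _.
have -> : size (1 - 'X : {poly R}) = 2%N.
  by rewrite -opprB size_polyN size_XsubC.
by rewrite mul1n.
Qed.

(** The square root solves 2 t y' = y.  The recurrence of the coefficients makes
    its Taylor polynomial solve the same equation up to the single term that the
    truncation does not cancel. *)
Lemma sqrt_taylor_ode d t :
  2 * t * (sqrt_taylor d)^`().[t] - (sqrt_taylor d).[t] =
  (2 * d%:R - 1) * sqrt_coef d * (1 - t) ^+ d.
Proof.
elim: d => [|d IH].
  rewrite /sqrt_taylor big_ord1 expr0 alg_polyC derivC horner0 hornerC /=.
  by ring.
have -> : sqrt_taylor d.+1 =
    sqrt_taylor d + sqrt_coef d.+1 *: (1 - 'X) ^+ d.+1.
  by rewrite /sqrt_taylor big_ord_recr.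
have e : (2 * d%:R - 1) * sqrt_coef d = 2 * d.+1%:R * sqrt_coef d.+1.
  by rewrite /=; field; rewrite addrC natr1 pnatr_eq0.
move: (sqrt_coef d.+1) e => b e; rewrite e in IH.
rewrite derivD !hornerD derivZ deriv_exp derivB derivX derivC !hornerZ.
rewrite hornerMn hornerM !horner_exp !hornerE -[-1 * _ *+ _]mulr_natr.
rewrite [d.+1.-1]/=.
have -> : forall A B X Y : R, A * (B + b * X) - (Y + b * (1 - t) ^+ d.+1) =
  A * B - Y + (A * X - (1 - t) ^+ d.+1) * b by move=> *; ring.
by rewrite IH -[d.+1%:R]natr1 exprS; ring.
Qed.

Lemma sqrt_taylor_at1 d : (sqrt_taylor d).[1] = 1.
Proof.
rewrite /sqrt_taylor big_ord_recl hornerD horner_sum big1 => [|i _].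
  by rewrite expr0 alg_polyC hornerC addr0.
by rewrite hornerZ horner_exp !hornerE subrr expr0n mulr0.
Qed.

(** By [sqrt_taylor_ode] the quotient g = q / sqrt of the Taylor polynomial q by
    the square root has derivative
    (2d - 1) b_d (1 - t)^d / (2 t sqrt t), where b_d is the last coefficient.
    Since g(1) = 1, the mean value theorem bounds g - 1. *)
Lemma sqrt_taylor_error a t d : 0 < a -> a <= t <= 1 -> (0 < d)%N ->
  `|(sqrt_taylor d).[t] - Num.sqrt t| <= d%:R / a ^+ 2 * (1 - a) ^+ d.
Proof.
move=> a0 /andP[at_ t1] d0.
have t0 : 0 < t by exact: lt_le_trans at_.
set q := sqrt_taylor d.
pose g x := q.[x] * (Num.sqrt x)^-1.
pose dg x := (2 * d%:R - 1) * sqrt_coef d * (1 - x) ^+ d / (2 * x * Num.sqrt x).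
have gd (x : R) : 0 < x -> is_derive x 1 g (dg x).
  move=> x0.
  have s0 : Num.sqrt x != 0 by rewrite gt_eqF// sqrtr_gt0.
  have sx : x = Num.sqrt x ^+ 2 by rewrite sqr_sqrtr// ltW.
  pose h1 := is_derive1_sqrt x0.
  pose h2 := is_deriveV s0 h1.
  apply: (is_derive_eq (is_deriveM (is_derive_poly q x) h2)).
  rewrite /dg -sqrt_taylor_ode -/q /GRing.scale /=.
  move: s0 {h1 h2}; set s := Num.sqrt x => s0.
  by move: q.[x] q^`().[x] => A B; rewrite sx -/s; field.
have [c cI eqg] : exists2 c, c \in `[t, 1]%R & g 1 - g t = dg c * (1 - t).
  apply: MVT_segment => // [x|].
    by rewrite in_itv /= => /andP[tx _]; apply: gd; exact: lt_trans tx.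
  apply: derivable_within_continuous => x.
  rewrite in_itv /= => /andP[tx _]; have [] // := gd x _.
  exact: lt_le_trans tx.
have s0 : 0 < Num.sqrt t by rewrite sqrtr_gt0.
have s1 : Num.sqrt t <= 1 by rewrite -sqrtr1 ler_wsqrtr.
have -> : q.[t] - Num.sqrt t = Num.sqrt t * (g t - g 1).
  rewrite /g sqrt_taylor_at1 sqrtr1 invr1 mulr1 mulrBr mulrCA mulfV ?mulr1//.
  by rewrite gt_eqF.
rewrite normrM (gtr0_norm s0) distrC eqg.
move: cI; rewrite in_itv /= => /andP[tc c1].
have ac : a <= c by exact: le_trans tc.
have c0 : 0 < c by exact: lt_le_trans ac.
have sc0 : 0 < Num.sqrt c by rewrite sqrtr_gt0.
have sc : c <= Num.sqrt c.
  rewrite -{1}[c]sqr_sqrtr ?(ltW c0)// expr2 ger_pMr//.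
  by rewrite -sqrtr1 ler_wsqrtr.
have d1 : 1 <= d%:R :> R by rewrite ler1n.
apply: (@le_trans _ _ `|dg c|).
  rewrite -[leRHS]mul1r ler_pM ?normr_ge0 ?(ltW s0)// normrM ler_piMr//.
  by rewrite ger0_norm ?subr_ge0// lerBlDr lerDl ltW.
rewrite /dg !normrM (ger0_norm (_ : 0 <= 2 * d%:R - 1)); last by lra.
rewrite [`|(1 - c) ^+ d|]ger0_norm ?exprn_ge0 ?subr_ge0//.
rewrite normfV (ger0_norm (_ : 0 <= 2 * c * Num.sqrt c)); last first.
  by rewrite !mulr_ge0// ltW.
rewrite [leRHS]mulrAC.
have -> : d%:R * (1 - a) ^+ d / a ^+ 2 =
    (2 * d%:R) * 1 * (1 - a) ^+ d / (2 * a ^+ 2).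
  by field; rewrite gt_eqF.
apply: ler_pM.
- by rewrite !mulr_ge0 ?exprn_ge0 ?subr_ge0//; lra.
- by rewrite invr_ge0 !mulr_ge0 ?ltW.
- apply: ler_pM; rewrite ?exprn_ge0 ?subr_ge0 ?mulr_ge0//; first by lra.
    by apply: ler_pM; rewrite ?sqrt_coef_le1//; lra.
  by rewrite lerXn2r ?nnegrE ?subr_ge0//; lra.
- rewrite lef_pV2 ?posrE ?mulr_gt0 ?exprn_gt0//.
  rewrite -mulrA ler_pM2l// expr2 ler_pM ?(ltW a0)//.
  exact: le_trans sc.
Qed.

End Taylor.

(** * Square root approximations from Fejer kernels *)

Section SqrtZero.
Variable R : realType.
Implicit Types (t u : R) (n : nat).

(** Consecutive Fejer kernels: for t = sin^2 x, the value of [fejer n] at t is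
    (sin (n x) / sin x)^2, and the three-term recurrence is the one satisfied by
    sin^2 (n x). *)
Fixpoint fejer_pair n : {poly R} * {poly R} :=
  if n is m.+1 then
    let: (p, q) := fejer_pair m in
    (q, 2%:P + (2 *: (1 - 2 *: 'X)) * q - p)
  else (0, 1).

Definition fejer n := (fejer_pair n).1.

Lemma fejer0 : fejer 0 = 0. Proof. by []. Qed.
Lemma fejer1 : fejer 1 = 1. Proof. by []. Qed.
Lemma fejerSS n :
  fejer n.+2 = 2%:P + (2 *: (1 - 2 *: 'X)) * fejer n.+1 - fejer n.
Proof. by rewrite /fejer /=; case: (fejer_pair n). Qed.

Lemma horner_fejerSS n t : (fejer n.+2).[t] =
  2 + 2 * (1 - 2 * t) * (fejer n.+1).[t] - (fejer n).[t].
Proof. by rewrite fejerSS !hornerE. Qed.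

Lemma size_fejer n : (size (fejer n) <= n)%N.
Proof.
suff : (size (fejer n) <= n)%N /\ (size (fejer n.+1) <= n.+1)%N by case.
elim: n => [|n [IH1 IH2]]; first by rewrite fejer0 fejer1 size_poly0 size_poly1.
split=> //; rewrite fejerSS.
apply: leq_trans (size_polyD _ _) _; rewrite size_polyN geq_max.
rewrite (leq_trans IH1) ?andbT; last by rewrite ltnW.
apply: leq_trans (size_polyD _ _) _; rewrite geq_max.
rewrite (leq_trans (size_polyC_leq1 _))//=.
apply: leq_trans (size_polyMleq _ _) _.
have h : (size (2 *: (1 - 2 *: 'X) : {poly R}) <= 2)%N.
  apply: leq_trans (size_scale_leq _ _) _.
  apply: leq_trans (size_polyD _ _) _; rewrite size_polyN geq_max size_poly1 /=.
  by apply: leq_trans (size_scale_leq _ _) _; rewrite size_polyX.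
have := leq_add h IH2; rewrite addSn add1n => h2.
by case: (_ + _)%N h2.
Qed.

(** Here t = sin^2 x, sqrt (1 - t) = cos x, c = cos (n x) and
    s = sin (n x) / sin x.  The first equation is cos^2 + sin^2 = 1, and
    the addition formulas give the recurrence. *)
Lemma fejer_pell n t : 0 <= t <= 1 ->
  exists c s : R, [/\ c ^+ 2 + t * s ^+ 2 = 1, (fejer n).[t] = s ^+ 2 &
    (fejer n.+1).[t] = (Num.sqrt (1 - t) * s + c) ^+ 2].
Proof.
move=> /andP[t0 t1].
have : Num.sqrt (1 - t) ^+ 2 = 1 - t by rewrite sqr_sqrtr ?subr_ge0.
set y := Num.sqrt _ => ey.
elim: n => [|n [c [s [e1 e2 e3]]]].
  by exists 1, 0; rewrite fejer0 fejer1 !hornerE /=; split; ring.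
exists (y * c - t * s), (y * s + c); split=> //.
  rewrite -[RHS]e1; have -> : t = 1 - y ^+ 2 by rewrite ey; ring.
  by ring.
rewrite horner_fejerSS e3 e2.
have -> : forall A, 2 + A - s ^+ 2 = 2 * (c ^+ 2 + t * s ^+ 2) + A - s ^+ 2.
  by move=> A; rewrite e1 mulr1.
have -> : t = 1 - y ^+ 2 by rewrite ey; ring.
by ring.
Qed.

Lemma fejer_ge0 n t : 0 <= t <= 1 -> 0 <= (fejer n).[t].
Proof. by move=> /(fejer_pell n)[c [s [_ -> _]]]; exact: sqr_ge0. Qed.

Lemma fejer_le_inv n t : 0 <= t <= 1 -> t * (fejer n).[t] <= 1.
Proof.
by move=> /(fejer_pell n)[c [s [<- -> _]]]; rewrite lerDr sqr_ge0.
Qed.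

(** The second differences in n of the kernel are 2 - 4 t F_n <= 2. *)
Lemma fejer_ub n t : 0 <= t <= 1 -> (fejer n).[t] <= n%:R ^+ 2.
Proof.
move=> t01; have /andP[t0 _] := t01.
suff [] : (fejer n).[t] <= n%:R ^+ 2 /\
    (fejer n.+1).[t] - (fejer n).[t] <= 2 * n%:R + 1 by [].
elim: n => [|n [IH1 IH2]].
  by rewrite fejer0 fejer1 !hornerE; split; lra.
have h := fejer_ge0 n.+1 t01; rewrite horner_fejerSS -[n.+1%:R]natr1.
have th : 0 <= t * (fejer n.+1).[t] by rewrite mulr_ge0.
by split; nra.
Qed.

(** By [fejer_ub] the second differences in n of n^2 - F_n are at most 4 t n^2,
    which is less than those of t n^4 / 3. *)
Lemma fejer_lb n t : 0 <= t <= 1 ->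
  n%:R ^+ 2 - t * n%:R ^+ 4 / 3 <= (fejer n).[t].
Proof.
move=> t01; have /andP[t0 _] := t01.
suff [] : n%:R ^+ 2 - t * n%:R ^+ 4 / 3 <= (fejer n).[t] /\
    n.+1%:R ^+ 2 - t * n.+1%:R ^+ 4 / 3 - (n%:R ^+ 2 - t * n%:R ^+ 4 / 3)
    <= (fejer n.+1).[t] - (fejer n).[t] by [].
elim: n => [|n [IH1 IH2]].
  rewrite fejer0 fejer1 !hornerE /= !expr0n !expr1n /=.
  split; lra.
have h : t * (fejer n.+1).[t] <= t * n.+1%:R ^+ 2.
  by rewrite ler_wpM2l ?fejer_ub.
split; first lra.
rewrite horner_fejerSS.
move: IH1 IH2 h; rewrite -[n.+2%:R]natr1 -[n.+1%:R]natr1.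
move: n%:R (fejer n).[t] (fejer n.+1).[t] => N A B IH1 IH2 h.
by lra.
Qed.

(** Termwise integral of v |-> F_n(t v^2) over [0, 1]. *)
Definition fejer_int n : {poly R} :=
  \sum_(j < n) ((fejer n)`_j / (2 * j + 1)%:R) *: 'X^j.

(** The primitive P of u |-> F_n(u^2) that vanishes at 0. *)
Definition fejer_prim n : {poly R} := 'X * (fejer_int n \Po 'X^2).

Lemma fejer_primE n u : (fejer_prim n).[u] = u * (fejer_int n).[u ^+ 2].
Proof. by rewrite /fejer_prim hornerM horner_comp hornerX hornerXn. Qed.

Lemma deriv_fejer_prim n u : (fejer_prim n)^`().[u] = (fejer n).[u ^+ 2].
Proof.
have -> : fejer_prim n =
    \sum_(j < n) ((fejer n)`_j / (2 * j + 1)%:R) *: 'X^(2 * j + 1).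
  rewrite /fejer_prim /fejer_int raddf_sum mulr_sumr; apply: eq_bigr => j _.
  by rewrite /= comp_polyZ comp_Xn_poly -exprM addn1 exprS scalerAr.
rewrite raddf_sum horner_sum (horner_coef_wide _ (size_fejer n)).
apply: eq_bigr => j _; rewrite /= derivZ derivXn hornerZ hornerMn hornerXn.
have h : (2 * j + 1)%:R != 0 :> R by rewrite addn1 pnatr_eq0.
have -> : (2 * j + 1).-1 = (2 * j)%N by rewrite addn1.
rewrite -[u ^+ _ *+ _]mulr_natr exprM.
by move: (_%:R) h => D h; field.
Qed.

Lemma is_derive_le (f df : R -> R) (a b : R) : a <= b ->
  (forall x, a <= x <= b -> is_derive x 1 f (df x)) ->
  (forall x, a <= x <= b -> 0 <= df x) -> f a <= f b.
Proof.
move=> ab fd df0.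
have [c cI eqf] : exists2 c, c \in `[a, b]%R & f b - f a = df c * (b - a).
  apply: MVT_segment => // [x|].
    by rewrite in_itv /= => /andP[ax xb]; apply: fd; rewrite !ltW.
  apply: derivable_within_continuous => x.
  by rewrite in_itv /= => xI; have [] := fd x xI.
by rewrite -subr_ge0 eqf mulr_ge0 ?subr_ge0// df0 -?in_itv.
Qed.

Lemma fejer_prim_ndecr n u : 0 <= u <= 1 ->
  (fejer_prim n).[u] <= (fejer_prim n).[1].
Proof.
move=> /andP[u0 u1].
apply: (@is_derive_le (horner (fejer_prim n))
  (fun x => (fejer_prim n)^`().[x])) => // x /andP[ux x1].
have x0 : 0 <= x by exact: le_trans ux.
by rewrite deriv_fejer_prim fejer_ge0// exprn_ge0// exprn_ile1.
Qed.

(** Since F_n(v^2) <= v^-2, the function v^-1 + P(v) is nonincreasing; compare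
    its values at u and 1. *)
Lemma fejer_prim_tail n u : 0 < u <= 1 ->
  u * ((fejer_prim n).[1] - (fejer_prim n).[u]) <= 1 - u.
Proof.
move=> /andP[u0 u1].
pose h x := x^-1 + (fejer_prim n).[x].
pose dh x := - x ^- 2 + (fejer n).[x ^+ 2].
suff H : - h u <= - h 1.
  rewrite -[leRHS](_ : u * (u^-1 - 1) = _); last first.
    by rewrite mulrBr mulr1 mulfV ?gt_eqF.
  by rewrite ler_wpM2l ?(ltW u0)//; move: H; rewrite /h invr1; lra.
apply: (@is_derive_le (fun x => - h x) (fun x => - dh x)) => // x /andP[ux x1].
  have x0 : x != 0 by rewrite gt_eqF// (lt_le_trans u0).
  pose k1 := is_deriveV x0 (is_derive_id x 1).
  pose k2 := is_derive_poly (fejer_prim n) x.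
  apply: (is_derive_eq (is_deriveN (is_deriveD k1 k2))).
  by rewrite /dh deriv_fejer_prim /GRing.scale /= mulr1.
have x0 : 0 < x by rewrite (lt_le_trans u0).
rewrite /dh opprD opprK subr_ge0 -[leRHS]mul1r ler_pdivlMr ?exprn_gt0//.
have x0' := ltW x0.
by rewrite mulrC fejer_le_inv// exprn_ge0//= exprn_ile1.
Qed.

(** By [fejer_lb] the kernel is of size n^2 on [0, 1/n]; integrating that lower
    bound over this interval gives n - n/9. *)
Lemma fejer_prim_lb n : (0 < n)%N -> 8 / 9 * n%:R <= (fejer_prim n).[1].
Proof.
move=> n0; have n1 : 1 <= n%:R :> R by rewrite ler1n.
have N0 : 0 < n%:R :> R by lra.
pose e : R := n%:R^-1.
have e01 : 0 <= e <= 1 by rewrite invr_ge0 (ltW N0)/= invf_le1.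
apply: le_trans (fejer_prim_ndecr n e01).
pose q : {poly R} := fejer_prim n - n%:R ^+ 2 *: 'X + (n%:R ^+ 4 / 9) *: 'X^3.
have : q.[0] <= q.[e].
  apply: (@is_derive_le (horner q) (fun x => q^`().[x])).
  - by case/andP: e01.
  - move=> x /andP[x0 xe].
    have x1 : x <= 1 by case/andP: e01 => _; exact: le_trans.
    have xx : 0 <= x ^+ 2 <= 1 by rewrite exprn_ge0// exprn_ile1.
    have := fejer_lb n xx.
    rewrite /q derivD derivB !derivZ derivX derivXn !hornerD hornerN.
    rewrite deriv_fejer_prim !hornerE /=.
    by lra.
have : (fejer_prim n).[0] = 0 by rewrite fejer_primE mul0r.
rewrite /q; move: (fejer_prim n) => P P0.
rewrite !hornerD !hornerN !hornerZ !hornerX !hornerXn P0 expr0n /= !mulr0.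
have -> : n%:R ^+ 2 * e = n%:R by rewrite expr2 mulfK ?gt_eqF.
have -> : n%:R ^+ 4 / 9 * e ^+ 3 = n%:R / 9.
  by rewrite /e; field; rewrite gt_eqF.
by lra.
Qed.

(** At t = u^2 this is u P(u) / P(1); written with [fejer_int] it is visibly a
    polynomial in t. *)
Definition sqrt_fejer n : {poly R} :=
  ((fejer_prim n).[1])^-1 *: ('X * fejer_int n).

Lemma size_sqrt_fejer n : (size (sqrt_fejer n) <= n.+1)%N.
Proof.
apply: leq_trans (size_scale_leq _ _) _.
apply: leq_trans (size_polyMleq _ _) _; rewrite size_polyX add2n ltnS.
apply: leq_trans (size_sum _ _ _) _; apply/bigmax_leqP => -[j /= jn] _.
by apply: leq_trans (size_scale_leq _ _) _; rewrite size_polyXn.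
Qed.

(** The error at u^2 is u (P(1) - P(u)) / P(1).  The numerator is at most 1 by
    [fejer_prim_tail] and the denominator is of order n by [fejer_prim_lb]. *)
Lemma sqrt_fejer_error n t : (0 < n)%N -> 0 <= t <= 1 ->
  `|(sqrt_fejer n).[t] - Num.sqrt t| <= 9 / 8 / n%:R.
Proof.
move=> n0 /andP[t0 t1]; have n1 : 1 <= n%:R :> R by rewrite ler1n.
have Zlb := fejer_prim_lb n0.
have Z0 : 0 < (fejer_prim n).[1] by lra.
have u0 : 0 <= Num.sqrt t by exact: sqrtr_ge0.
have u1 : Num.sqrt t <= 1 by rewrite -sqrtr1 ler_wsqrtr.
have {1}-> : t = Num.sqrt t ^+ 2 by rewrite sqr_sqrtr.
set u := Num.sqrt t in u0 u1 *.
have -> : (sqrt_fejer n).[u ^+ 2] - u =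
    - (u * ((fejer_prim n).[1] - (fejer_prim n).[u]) / (fejer_prim n).[1]).
  have -> : (sqrt_fejer n).[u ^+ 2] =
      (fejer_prim n).[1]^-1 * (u * (fejer_prim n).[u]).
    rewrite /sqrt_fejer hornerZ; congr (_ * _).
    by rewrite hornerM hornerX fejer_primE expr2 mulrA.
  by move: (fejer_prim n) Z0 => P Z0; field; rewrite gt_eqF.
have P0 : 0 <= u * ((fejer_prim n).[1] - (fejer_prim n).[u]).
  by rewrite mulr_ge0// subr_ge0 fejer_prim_ndecr// u0.
have P1 : u * ((fejer_prim n).[1] - (fejer_prim n).[u]) <= 1.
  move: u0; rewrite le_eqVlt => /predU1P[<-|u0]; first by rewrite mul0r.
  have := @fejer_prim_tail n u; rewrite u0 u1 => /(_ isT); lra.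
rewrite normrN ger0_norm; last by rewrite mulr_ge0// invr_ge0 ltW.
rewrite ler_pdivrMr//.
apply: le_trans P1 _; rewrite mulrAC ler_pdivlMr ?mul1r; lra.
Qed.

End SqrtZero.

(** * The positive semidefinite program attains its minimum *)

Section PsdMin.
Variable R : realType.
Local Notation C := R[i].
Local Open Scope sesquilinear_scope.
Implicit Types (z : C).

Lemma sqr_normcE z : Normc.normc z ^+ 2 = complex.Re z ^+ 2 + complex.Im z ^+ 2.
Proof. by case: z => a b /=; rewrite sqr_sqrtr// addr_ge0 ?sqr_ge0. Qed.

Lemma hermsymmxP n (Q : 'M[C]_n) :
  (forall i j, Q i j = (Q j i)^*%R) <-> Q \is hermsymmx.
Proof.
split=> [h|/is_hermitianmxP h i j].
  by apply/is_hermitianmxP/matrixP => i j; rewrite expr0 scale1r !mxE.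
by rewrite {1}h expr0 scale1r !mxE.
Qed.

Section PsdEntries.
Variables (n : nat) (Q : 'M[C]_n).
Hypothesis Qpsd : psdmx Q.

Let qf (v w : 'cV[C]_n) : C := (v^t* *m Q *m w) 0 0.

Let qfDl v1 v2 w : qf (v1 + v2) w = qf v1 w + qf v2 w.
Proof. by rewrite /qf linearD map_mxD !mulmxDl mxE. Qed.
Let qfDr v w1 w2 : qf v (w1 + w2) = qf v w1 + qf v w2.
Proof. by rewrite /qf mulmxDr mxE. Qed.
Let qfZl a v w : qf (a *: v) w = a^*%R * qf v w.
Proof. by rewrite /qf linearZ map_mxZ -!scalemxAl mxE. Qed.
Let qfZr a v w : qf v (a *: w) = a * qf v w.
Proof. by rewrite /qf -scalemxAr mxE. Qed.
Let qfE i j : qf (delta_mx i 0) (delta_mx j 0) = Q i j.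
Proof.
by rewrite /qf trmx_delta map_delta_mx -rowE -colE !mxE. Qed.

Lemma psd_diag_ge0 i : 0 <= Q i i.
Proof. by case: Qpsd => _ /(_ (delta_mx i 0)); rewrite -/(qf _ _) qfE. Qed.

Lemma psd_pair_ge0 i j z :
  0 <= Q i i + z * Q i j + (z^*%R * Q j i + z^*%R * (z * Q j j)).
Proof.
case: Qpsd => _ /(_ (delta_mx i 0 + z *: delta_mx j 0)).
by rewrite -/(qf _ _) qfDl !qfDr !qfZl !qfZr !qfE.
Qed.

Lemma psd_Re_diag i : 0 <= complex.Re (Q i i).
Proof. by have := psd_diag_ge0 i; rewrite lecE => /andP[]. Qed.

(** Positivity of the form at e_i + z e_j for the four fourth roots of unity z
    isolates the real and imaginary parts of the entry. *)
Lemma psd_entry_le i j :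
  `|complex.Re (Q i j)| <= (complex.Re (Q i i) + complex.Re (Q j j)) / 2 /\
  `|complex.Im (Q i j)| <= (complex.Re (Q i i) + complex.Re (Q j j)) / 2.
Proof.
have Qji : Q j i = (Q i j)^*%R by case: Qpsd => /hermsymmxP.
have h z : 0 <= complex.Re
    (Q i i + z * Q i j + (z^*%R * Q j i + z^*%R * (z * Q j j))).
  by have := psd_pair_ge0 i j z; rewrite lecE => /andP[].
have h1 := h 1; have h2 := h (- 1); have h3 := h 'i%C; have h4 := h (- 'i%C).
move: h1 h2 h3 h4; rewrite Qji {h Qji}.
case: (Q i i) (Q i j) (Q j j) => [a b] [c d] [e f] /=.
by move=> h1 h2 h3 h4; rewrite !ler_norml; split; apply/andP; split; lra.
Qed.

Lemma psd_entry_trace i j :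
  `|complex.Re (Q i j)| <= \sum_k complex.Re (Q k k) /\
  `|complex.Im (Q i j)| <= \sum_k complex.Re (Q k k).
Proof.
have le_tr k : complex.Re (Q k k) <= \sum_k complex.Re (Q k k).
  by rewrite (bigD1 k)//= lerDl sumr_ge0// => l _; exact: psd_Re_diag.
have [h1 h2] := psd_entry_le i j.
by have := le_tr i; have := le_tr j; split; lra.
Qed.

End PsdEntries.

Lemma gcoef_sum (gT : finGroupType) (J : Type) (s : seq J)
    (F : J -> galg C gT) x :
  gcoef (\sum_(j <- s) F j) x = \sum_(j <- s) gcoef (F j) x.
Proof.
elim: s => [|j s IH]; first by rewrite !big_nil gcoef0.
by rewrite !big_cons gcoefD IH.
Qed.

Lemma gcoef_gram (gT : finGroupType) (S : {set gT}) (Q : 'M[C]_#|S|) x :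
  gcoef (galg_gram Q) x = \sum_i \sum_j Q i j *
    ((x == (enum_val i)^-1 * enum_val j)%g)%:R.
Proof.
rewrite /galg_gram gcoef_sum; apply: eq_bigr => i _.
rewrite gcoef_sum; apply: eq_bigr => j _.
by rewrite gcoefZ galg_of_funE.
Qed.

(** The trace is read off at the identity.  This is what makes the program
    coercive: a small error bounds the trace, hence all entries. *)
Lemma gcoef_gram1 (gT : finGroupType) (S : {set gT}) (Q : 'M[C]_#|S|) :
  gcoef (galg_gram Q) 1%g = \tr Q.
Proof.
rewrite gcoef_gram; apply: eq_bigr => i _.
rewrite (bigD1 i)//= mulVg eqxx mulr1 big1 ?addr0// => j ji.
rewrite eq_sym -eq_mulVg1 (inj_eq enum_val_inj) eq_sym (negPf ji).
by rewrite mulr0.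
Qed.

(** Continuity of a complex-valued function through its real coordinates, which
    is the form in which the closed conditions below use it. *)
Definition ccont (T : topologicalType) (h : T -> C) :=
  continuous (fun x => complex.Re (h x)) /\
  continuous (fun x => complex.Im (h x)).

Lemma ccont_cst (T : topologicalType) z : ccont (fun _ : T => z).
Proof. by split; exact: cst_continuous. Qed.

Lemma ccontD (T : topologicalType) (f g : T -> C) :
  ccont f -> ccont g -> ccont (fun x => f x + g x).
Proof.
move=> [f1 f2] [g1 g2]; split => x.
  have -> : (fun x => complex.Re (f x + g x)) =
    (fun x => complex.Re (f x) + complex.Re (g x)).
    by apply/funext => y; case: (f y) (g y) => [? ?] [? ?].
  exact: (continuousD (f1 x) (g1 x)).
have -> : (fun x => complex.Im (f x + g x)) =
  (fun x => complex.Im (f x) + complex.Im (g x)).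
  by apply/funext => y; case: (f y) (g y) => [? ?] [? ?].
exact: (continuousD (f2 x) (g2 x)).
Qed.

Lemma ccontM (T : topologicalType) (f g : T -> C) :
  ccont f -> ccont g -> ccont (fun x => f x * g x).
Proof.
move=> [f1 f2] [g1 g2]; split => x.
  have -> : (fun x => complex.Re (f x * g x)) =
    (fun x => complex.Re (f x) * complex.Re (g x) -
              complex.Im (f x) * complex.Im (g x)).
    by apply/funext => y; case: (f y) (g y) => [? ?] [? ?].
  apply: (@continuousB _ _ _ _ _ x).
    exact: (continuousM (f1 x) (g1 x)).
  exact: (continuousM (f2 x) (g2 x)).
have -> : (fun x => complex.Im (f x * g x)) =
  (fun x => complex.Re (f x) * complex.Im (g x) +
            complex.Im (f x) * complex.Re (g x)).
  by apply/funext => y; case: (f y) (g y) => [? ?] [? ?].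
apply: (@continuousD _ _ _ _ _ x).
  exact: (continuousM (f1 x) (g2 x)).
exact: (continuousM (f2 x) (g1 x)).
Qed.

Lemma ccont_sum (T : topologicalType) (J : Type) (s : seq J) (F : J -> T -> C) :
  (forall j, ccont (F j)) -> ccont (fun x => \sum_(j <- s) F j x).
Proof.
move=> Fc; elim: s => [|j s IH].
  have -> : (fun x => \sum_(j <- [::]) F j x) = (fun=> 0).
    by apply/funext => x; rewrite big_nil.
  exact: ccont_cst.
have -> : (fun x => \sum_(j <- j :: s) F j x) =
    (fun x => F j x + \sum_(j <- s) F j x).
  by apply/funext => x; rewrite big_cons.
exact: ccontD.
Qed.

Section Gram.
Local Open Scope classical_set_scope.
Variables (gT : finGroupType) (S : {set gT}) (f : galg C gT).
Let n := #|S|.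
Let V : topologicalType := {ptws ('I_n * 'I_n * bool)%type -> R}.

Definition mx_of_reals (u : V) : 'M[C]_n :=
  \matrix_(i, j) (u (i, j, false) +i* u (i, j, true))%C.

Definition reals_of_mx (Q : 'M[C]_n) : V := fun k =>
  if k.2 then complex.Im (Q k.1.1 k.1.2) else complex.Re (Q k.1.1 k.1.2).

Lemma reals_of_mxK Q : mx_of_reals (reals_of_mx Q) = Q.
Proof.
by apply/matrixP => i j; rewrite mxE /reals_of_mx /=; case: (Q i j).
Qed.

Lemma ccont_entry i j : ccont (fun u => mx_of_reals u i j).
Proof.
split.
  have -> : (fun u => complex.Re (mx_of_reals u i j)) =
      (fun u : V => u (i, j, false)).
    by apply/funext => u; rewrite mxE.
  exact: continuous_coord.
have -> : (fun u => complex.Im (mx_of_reals u i j)) =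
    (fun u : V => u (i, j, true)).
  by apply/funext => u; rewrite mxE.
exact: continuous_coord.
Qed.

Lemma closed_psd : closed [set u | psdmx (mx_of_reals u)].
Proof.
have -> : [set u | psdmx (mx_of_reals u)] =
  (\bigcap_(ij in [set: 'I_n * 'I_n])
    ([set u : V | u (ij.1, ij.2, false) - u (ij.2, ij.1, false) = 0] `&`
     [set u : V | u (ij.1, ij.2, true) + u (ij.2, ij.1, true) = 0])) `&`
  (\bigcap_(v in [set: 'cV[C]_n])
    ([set u | complex.Im ((v^t* *m mx_of_reals u *m v) 0 0) = 0] `&`
     [set u | 0 <= complex.Re ((v^t* *m mx_of_reals u *m v) 0 0)])).
  apply/seteqP; split=> u /=.
    move=> [/hermsymmxP h p]; split=> [[i j] _|v _] /=.
      by have := h i j; rewrite !mxE => -[-> ->]; rewrite subrr addNr.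
    by have := p v; rewrite lecE => /andP[/eqP].
  move=> [h p]; split.
    apply/hermsymmxP => i j; rewrite !mxE.
    have [/= /eqP h1 /eqP h2] := h (i, j) I.
    by move: h1 h2; rewrite subr_eq0 addr_eq0 => /eqP -> /eqP ->.
  by move=> v; have [/= e1 e2] := p v I; rewrite lecE e1 eqxx.
apply: closedI.
  apply: closed_bigI => -[i j] _; apply: closedI; apply: closed_eq_fun => u.
    exact: (continuousB (@continuous_coord R _ _ u)
              (@continuous_coord R _ _ u)).
  exact: (continuousD (@continuous_coord R _ _ u) (@continuous_coord R _ _ u)).
apply: closed_bigI => v _.
have [hR hI] : ccont (fun u => (v^t* *m mx_of_reals u *m v) 0 0).
  have -> : (fun u => (v^t* *m mx_of_reals u *m v) 0 0) =
    (fun u => \sum_j (\sum_i (v^t*) 0 i * mx_of_reals u i j) * v j 0).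
    by apply/funext => u; rewrite mxE; apply: eq_bigr => j _; rewrite mxE.
  apply: ccont_sum => j.
  have h : ccont (fun u => \sum_i (v^t*) 0 i * mx_of_reals u i j).
    by apply: ccont_sum => i; exact: (ccontM (ccont_cst _ _) (ccont_entry _ _)).
  exact: (ccontM h (ccont_cst _ _)).
by apply: closedI; [exact: closed_eq_fun | exact: closed_ge_fun].
Qed.

Lemma closed_gram_error m :
  closed [set u | sq_l2norm (f - galg_gram (mx_of_reals u)) <= m].
Proof.
apply: closed_le_fun.
have -> : (fun u => sq_l2norm (f - galg_gram (mx_of_reals u))) = (fun u =>
    \sum_x (complex.Re (gcoef (f - galg_gram (mx_of_reals u)) x) *
            complex.Re (gcoef (f - galg_gram (mx_of_reals u)) x) +
            complex.Im (gcoef (f - galg_gram (mx_of_reals u)) x) *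
            complex.Im (gcoef (f - galg_gram (mx_of_reals u)) x))).
  by apply/funext => u; apply: eq_bigr => x _; rewrite sqr_normcE !expr2.
apply: continuous_big_sum => x.
have [hR hI] : ccont (fun u => gcoef (f - galg_gram (mx_of_reals u)) x).
  have -> : (fun u => gcoef (f - galg_gram (mx_of_reals u)) x) =
    (fun u => gcoef f x + (-1) * \sum_i \sum_j mx_of_reals u i j *
    ((x == (enum_val i)^-1 * enum_val j)%g)%:R).
    by apply/funext => u; rewrite gcoefB gcoef_gram mulN1r.
  apply: (ccontD (ccont_cst _ _)); apply: (ccontM (ccont_cst _ _)).
  apply: ccont_sum => i; apply: ccont_sum => j.
  exact: (ccontM (ccont_entry _ _) (ccont_cst _ _)).
move=> u.
have h1 := continuous_mul hR hR; have h2 := continuous_mul hI hI.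
exact: (continuousD (h1 u) (h2 u)).
Qed.

Lemma gram_min : exists2 Q : 'M[C]_n, psdmx Q &
  forall Q' : 'M[C]_n, psdmx Q' -> sq_l2norm (f - galg_gram (S := S) Q) <=
    sq_l2norm (f - galg_gram (S := S) Q').
Proof.
have [||m|u up umin] := @ptws_attains_min R ('I_n * 'I_n * bool)%type
  [set u | psdmx (mx_of_reals u)]
  (fun u => sq_l2norm (f - galg_gram (mx_of_reals u))).
- exists (reals_of_mx 0); rewrite /= reals_of_mxK; split.
    by apply/hermsymmxP => i j; rewrite !mxE rmorph0.
  by move=> v; rewrite mulmx0 mul0mx mxE.
- by move=> m; apply: closedI; [exact: closed_psd | exact: closed_gram_error].
(* The trace of Q is the coefficient at 1 of its Gram element, so it differs from
   that of f by some x with x^2 <= m, and |x| <= 1 + x^2. *)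
- exists (`|complex.Re (gcoef f 1%g)| + 1 + m) => u /= up um.
  have tr_le : \sum_k complex.Re (mx_of_reals u k k) <=
      `|complex.Re (gcoef f 1%g)| + 1 + m.
    have ReD : {morph (@complex.Re R) : x y / x + y} by move=> [? ?] [? ?].
    have /(congr1 (@complex.Re R)) := gcoef_gram1 (mx_of_reals u).
    rewrite /mxtrace.
    rewrite (big_morph _ ReD (id1 := 0))// => <-.
    set g := galg_gram _ in um *.
    have : complex.Re (gcoef f 1%g - gcoef g 1%g) ^+ 2 <= m.
      apply: le_trans um; rewrite /sq_l2norm (bigD1 1%g)//= -gcoefB sqr_normcE.
      rewrite -addrA lerDl addr_ge0 ?sqr_ge0// sumr_ge0// => x _.
      exact: sqr_ge0.
    case: (gcoef f 1%g) (gcoef g 1%g) => [a b] [c d] /= h.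
    have := sqr_ge0 (a - c + 1); have := sqr_ge0 (a - c).
    have := ler_norm a; lra.
  move=> [[i j] b] /=; have [h1 h2] := psd_entry_trace up i j.
  apply: le_trans tr_le; case: b; move: h1 h2.
    by rewrite [X in complex.Im X]mxE.
  by rewrite [X in complex.Re X]mxE.
- exists (mx_of_reals u) => // Q' Qp.
  by rewrite -(reals_of_mxK Q'); apply: umin; rewrite /= reals_of_mxK.
Qed.

End Gram.
End PsdMin.

(** * Spectral bound in the regular representation *)

Section UnitaryDiag.
Local Open Scope sesquilinear_scope.

(** Column r of a unitary conjugate of diag(d) has squared norm
    sum_i |d_i|^2 |P_ir|^2, and the |P_ir|^2 sum to 1. *)
Lemma unitary_diag_column_le (K : numClosedFieldType) (m : nat) (P : 'M[K]_m)
    (d : 'rV[K]_m) (M : K) (r : 'I_m) : P \is unitarymx ->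
  (forall i, `|d 0 i| <= M) ->
  ((invmx P *m diag_mx d *m P)^t* *m (invmx P *m diag_mx d *m P)) r r <= M ^+ 2.
Proof.
move=> uP dM; have Pu : P^t* = invmx P by rewrite invmx_unitary.
have -> : (invmx P *m diag_mx d *m P)^t* *m (invmx P *m diag_mx d *m P) =
    P^t* *m diag_mx (\row_i (`|d 0 i| ^+ 2)) *m P.
  rewrite !trmx_mul !map_mxM -Pu trmxCK !mulmxA mulmxtVK//.
  rewrite tr_diag_mx map_diag_mx -[_ *m diag_mx _ *m diag_mx _]mulmxA.
  rewrite mulmx_diag.
  by congr (_ *m diag_mx _ *m _); apply/rowP => i; rewrite !mxE normCKC.
have one : \sum_i `|P i r| ^+ 2 = 1.
  have : (P^t* *m P) r r = 1 by rewrite Pu mulVmx ?unitarymx_unit// mxE eqxx.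
  by move=> <-; rewrite mxE; apply: eq_bigr => i _; rewrite !mxE normCKC.
rewrite -[leRHS]mulr1 -one mulr_sumr mxE ler_sum// => i _.
rewrite mul_mx_diag !mxE mulrAC mulrC -normCKC ler_wpM2r ?exprn_ge0//.
by rewrite lerXn2r// nnegrE// (le_trans (normr_ge0 _) (dM i)).
Qed.

End UnitaryDiag.

Lemma lrmorphism_horner_diag (K : fieldType) (A : algType K) (m : nat)
    (pi : {lrmorphism A -> 'M[K]_m}) (x : A) (P : 'M[K]_m) (D : 'rV[K]_m) :
    P \in unitmx -> pi x = invmx P *m diag_mx D *m P ->
  forall q, pi (horner_alg x q) = invmx P *m diag_mx (\row_i q.[D 0 i]) *m P.
Proof.
move=> Pu pix; elim/poly_ind => [|q c IH].
  rewrite !rmorph0; have -> : \row_i (0 : {poly K}).[D 0 i] = 0.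
    by apply/rowP => i; rewrite !mxE horner0.
  by rewrite linear0 mulmx0 mul0mx.
rewrite rmorphD rmorphM /= horner_algX horner_algC rmorphD rmorphM /= IH pix.
rewrite linearZ rmorph1 /= -mulmxE.
have -> : \row_i (q * 'X + c%:P).[D 0 i] =
    \row_j ((\row_i q.[D 0 i]) 0 j * D 0 j) + const_mx c.
  by apply/rowP => i; rewrite !mxE !hornerE.
rewrite linearD /= mulmxDr mulmxDl -mulmx_diag diag_const_mx.
rewrite !mulmxA (mulmxK Pu); congr (_ + _).
by rewrite -scalemx1 -scalemxAr mulmx1 -scalemxAl mulVmx.
Qed.

Section GroupAlgebraSpectrum.
Variables (R : realType) (gT : finGroupType).
Local Notation C := R[i].
Local Notation n := #|gT|.
Local Open Scope sesquilinear_scope.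
Implicit Types (f g h : galg C gT) (p q : {poly R}) (a : R) (t : R).

Lemma sum_group (F : gT -> C) : \sum_(i < n) F (enum_val i) = \sum_x F x.
Proof. by rewrite [RHS]big_enum_val. Qed.

(** The matrix of left multiplication in the basis of group elements. *)
Definition regular_rep f : 'M[C]_n :=
  \matrix_(i, j) gcoef f (enum_val i * (enum_val j)^-1)%g.

Fact regular_rep_linear : linear regular_rep.
Proof.
by move=> c f g; apply/matrixP => i j; rewrite !mxE gcoefD gcoefZ.
Qed.
HB.instance Definition _ :=
  GRing.isLinear.Build C (galg C gT) 'M[C]_n _ regular_rep regular_rep_linear.

Lemma regular_rep_elt x :
  regular_rep (galg_elt C x) =
  \matrix_(i, j) (enum_val i == x * enum_val j)%g%:R.
Proof.
apply/matrixP => i j; rewrite !mxE galg_of_funE; congr (nat_of_bool _)%:R.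
by rewrite -(inj_eq (mulIg (enum_val j))) mulgKV.
Qed.

Fact regular_rep_monoid_morphism : monoid_morphism regular_rep.
Proof.
split=> [|f g]; apply/matrixP => i j.
  rewrite -[1]/(galg_elt C 1%g) regular_rep_elt !mxE mul1g.
  by rewrite (inj_eq enum_val_inj).
rewrite !mxE gcoefM; under [RHS]eq_bigr do rewrite !mxE.
rewrite (sum_group (fun y => gcoef f (enum_val i * y^-1)%g *
  gcoef g (y * (enum_val j)^-1)%g)).
rewrite (reindex_inj (@mulgI _ (enum_val i))) (reindex_inj invg_inj) /=.
apply: eq_bigr => y _; congr (_ * gcoef g _).
by rewrite invMg invgK -mulgA mulKg.
Qed.
HB.instance Definition _ := GRing.isMonoidMorphism.Build (galg C gT) 'M[C]_n
  regular_rep regular_rep_monoid_morphism.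

Lemma regular_rep_star f : regular_rep (galg_star f) = (regular_rep f)^t*.
Proof.
by apply/matrixP => i j; rewrite !mxE galg_of_funE invMg invgK.
Qed.

Lemma regular_rep_star_representation : star_representation regular_rep.
Proof.
split; last exact: regular_rep_star.
move=> x; apply/unitarymxP; rewrite -regular_rep_star.
have -> : galg_star (galg_elt C x) = galg_elt C x^-1%g.
  apply/galgP => y; rewrite !galg_of_funE rmorph_nat; congr (nat_of_bool _)%:R.
  by rewrite -(inj_eq invg_inj) invgK.
rewrite mulmxE -rmorphM /= -[RHS](rmorph1 regular_rep); congr regular_rep.
apply/galgP => y; rewrite gcoefM gcoef1 (bigD1 x)//= big1 => [|z /negPf zx].
  rewrite addr0 !galg_of_funE eqxx mul1r; congr (nat_of_bool _)%:R.
  by rewrite -(inj_eq (mulgI x)) mulKVg mulgV.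
by rewrite !galg_of_funE zx mul0r.
Qed.

Lemma gcoef_regular_rep f x :
  gcoef f x = regular_rep f (enum_rank x) (enum_rank 1%g).
Proof. by rewrite mxE !enum_rankK invg1 mulg1. Qed.

(** The coefficients of f form the column of its matrix indexed by the
    identity. *)
Lemma sq_l2normE f :
  (sq_l2norm f)%:C%C = ((regular_rep f)^t* *m regular_rep f)
    (enum_rank 1%g) (enum_rank 1%g).
Proof.
rewrite rmorph_sum mxE /=.
rewrite -(sum_group (fun x => ((Normc.normc (gcoef f x) ^+ 2)%:C)%C)).
apply: eq_bigr => i _; rewrite gcoef_regular_rep enum_valK !mxE.
by rewrite -normCKC rmorphXn.
Qed.

Section Diagonal.
Variables (a : R) (f : galg C gT).
Hypothesis fa : spectrum_in a f.

Let P := spectralmx (regular_rep f).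
Let D := spectral_diag (regular_rep f).

Lemma regular_rep_diag : regular_rep f = invmx P *m diag_mx D *m P.
Proof.
apply/orthomx_spectralP/hermitian_normalmx/is_hermitianmxP.
by rewrite expr0 scale1r -regular_rep_star; case: fa => <-.
Qed.

Let Punit : P \in unitmx. Proof. exact: spectral_unit. Qed.

(** Each diagonal entry is an eigenvalue, with the corresponding row of the
    unitary matrix as eigenvector, and the spectral hypothesis on f applies to
    the regular representation. *)
Lemma spectral_diag_in i : exists2 t, a <= t <= 1 & D 0 i = t%:C%C.
Proof.
have /(_ _ _ regular_rep_star_representation (D 0 i)) : forall (m : nat)
   (pi : {lrmorphism galg C gT -> 'M[C]_m}), star_representation pi ->
    forall b : C, eigenvalue (pi f) b -> (a%:C)%C <= b <= 1 by case: fa.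
move=> H; have {H} : (a%:C)%C <= D 0 i <= 1.
  apply: H; apply/eigenvalueP; exists (row i P).
    rewrite [X in _ *m X]regular_rep_diag -row_mul !mulmxA mulmxV// mul1mx.
    by rewrite row_mul row_diag_mx -scalemxAl -rowE.
  apply: contraTneq Punit => Pi0.
  have /matrixP/(_ 0 i) : row i (P *m invmx P) = 0.
    by rewrite row_mul Pi0 mul0mx.
  rewrite mulmxV ?Punit// !mxE eqxx => /eqP; by rewrite oner_eq0.
case: (D 0 i) => x y; rewrite !lecE /= => /andP[/andP[/eqP y0 ax] /andP[_ x1]].
by exists x; [rewrite ax|rewrite y0].
Qed.

Lemma sq_l2norm_eval_le q (M : R) :
  (forall t, a <= t <= 1 -> `|q.[t]| <= M) ->
  sq_l2norm (galg_eval q f) <= M ^+ 2.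
Proof.
move=> qM; rewrite -lecR sq_l2normE rmorphXn /=.
rewrite (lrmorphism_horner_diag Punit regular_rep_diag).
apply: unitary_diag_column_le; first exact: spectral_unitarymx.
move=> i; rewrite mxE; have [t t01 ->] := spectral_diag_in i.
by rewrite horner_map /= normc_def /= expr0n addr0 sqrtr_sqr lecR qM.
Qed.

End Diagonal.

Lemma gcoef_star f x : gcoef (galg_star f) x = (gcoef f x^-1%g)^*%R.
Proof. exact: galg_of_funE. Qed.

Lemma galg_starD f g : galg_star (f + g) = galg_star f + galg_star g.
Proof. by apply/galgP => x; rewrite gcoefD !gcoef_star gcoefD rmorphD. Qed.

Lemma galg_starM f g : galg_star (f * g) = galg_star g * galg_star f.
Proof.
apply/galgP => x; rewrite gcoef_star !gcoefM rmorph_sum.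
rewrite (reindex_inj (@mulgI _ x^-1%g)) /=; apply: eq_bigr => y _.
by rewrite rmorphM mulrC !gcoef_star !invMg !invgK mulgK.
Qed.

Lemma galg_star_real (c : R) : galg_star (c%:C%C%:A : galg C gT) = c%:C%C%:A.
Proof.
apply/galgP => x; rewrite gcoef_star !gcoefZ !gcoef1 rmorphM rmorph_nat.
by rewrite eq_invg1; congr (_ * _); exact: conjc_real.
Qed.

Lemma galg_evalE p f :
  galg_eval p f = horner_alg f (map_poly (real_complex R) p).
Proof. by []. Qed.

Lemma galg_evalX f : galg_eval 'X f = f.
Proof. by rewrite galg_evalE map_polyX horner_algX. Qed.
Lemma galg_evalB p q f : galg_eval (p - q) f = galg_eval p f - galg_eval q f.
Proof. by rewrite !galg_evalE rmorphB rmorphB. Qed.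
Lemma galg_evalM p q f : galg_eval (p * q) f = galg_eval p f * galg_eval q f.
Proof. by rewrite !galg_evalE rmorphM rmorphM. Qed.

Lemma galg_eval0 f : galg_eval 0 f = 0.
Proof. by rewrite galg_evalE rmorph0 rmorph0. Qed.
Lemma galg_evalC (c : R) f : galg_eval c%:P f = c%:C%C%:A.
Proof. by rewrite galg_evalE map_polyC horner_algC. Qed.
Lemma galg_evalD p q f : galg_eval (p + q) f = galg_eval p f + galg_eval q f.
Proof. by rewrite !galg_evalE rmorphD rmorphD. Qed.
Lemma galg_eval_comm p f : galg_eval p f * f = f * galg_eval p f.
Proof.
have h : galg_eval (p * 'X) f = galg_eval ('X * p) f by rewrite mulrC.
by rewrite !galg_evalM galg_evalX in h.
Qed.

Lemma galg_star_eval p f : f = galg_star f ->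
  galg_star (galg_eval p f) = galg_eval p f.
Proof.
move=> fs; elim/poly_ind: p => [|p c IH].
  by rewrite galg_eval0; apply/galgP => x; rewrite gcoef_star !gcoef0 rmorph0.
rewrite galg_evalD galg_evalM galg_evalX galg_evalC.
by rewrite galg_starD galg_star_real galg_starM IH -fs galg_eval_comm.
Qed.

Definition rank1_gram (S : {set gT}) h : 'M[C]_#|S| :=
  \matrix_(i, j) ((gcoef h (enum_val i))^*%R * gcoef h (enum_val j)).

(** The matrix is w^* w for the row w of coefficients of h. *)
Lemma rank1_gram_psd (S : {set gT}) h : psdmx (rank1_gram S h).
Proof.
split.
  apply/hermsymmxP => i j; rewrite !mxE rmorphM mulrC; congr (_ * _).
  exact/esym/conjCK.
move=> v; pose w : 'rV[C]_#|S| := \row_j gcoef h (enum_val j).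
have -> : rank1_gram S h = w^t* *m w.
  by apply/matrixP => i j; rewrite !mxE big_ord1 !mxE.
rewrite -mulmxA -mulmxA mulmxA -map_mxM -trmx_mul mxE big_ord1 !mxE.
by rewrite -normCKC exprn_ge0.
Qed.

(** Restricting both indices to S loses nothing since h vanishes outside S. *)
Lemma gram_rank1 (S : {set gT}) h : gsupp h \subset S ->
  galg_gram (rank1_gram S h) = galg_star h * h.
Proof.
move=> hS; apply/galgP => z; rewrite gcoef_gram gcoefM.
have out x : x \notin S -> gcoef h x = 0.
  move=> xS; apply/eqP; apply: contraNT xS => hx.
  by apply: (fintype.subsetP hS); rewrite inE.
have big_S (F : gT -> C) : (forall x, x \notin S -> F x = 0) ->
    \sum_(i < #|S|) F (enum_val i) = \sum_x F x.
  move=> F0; rewrite -[LHS]big_enum_val [RHS](bigID [in S])/=.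
  by rewrite [X in _ = _ + X]big1 ?addr0.
under eq_bigr => i _.
  under eq_bigr => j _ do rewrite mxE.
  rewrite (big_S (fun y => (gcoef h (enum_val i))^*%R * gcoef h y *
    ((z == (enum_val i)^-1 * y)%g)%:R)); last first.
    by move=> x /out ->; rewrite mulr0 mul0r.
  rewrite (bigD1 (enum_val i * z)%g)//= mulKg eqxx mulr1 big1; last first.
    move=> y /negPf yz; rewrite -(inj_eq (mulgI (enum_val i))) mulKVg eq_sym yz.
    by rewrite mulr0.
  rewrite addr0; over.
rewrite (big_S (fun x => (gcoef h x)^*%R * gcoef h (x * z)%g)); last first.
  by move=> x /out ->; rewrite rmorph0 mul0r.
rewrite (reindex_inj invg_inj); apply: eq_bigr => x _.
by rewrite gcoef_star.
Qed.

End GroupAlgebraSpectrum.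

(** * Rates of convergence *)

Section SosError.
Variable R : realType.

(** With |p - sqrt t| <= e one has
    |t - p^2| = |p - sqrt t| |2 sqrt t + (p - sqrt t)| <= e (2 + e). *)
Lemma sos_error_le (a : R) (gT : finGroupType) (f : galg R[i] gT) (d : nat)
    (q : {poly R}) (e : R) :
  0 <= a < 1 -> spectrum_in a f -> (size q <= d.+1)%N ->
  (forall t, a <= t <= 1 -> `|q.[t] - Num.sqrt t| <= e) ->
  exists2 rho : R, is_min (sos_errors a f d) rho & rho <= (e * (2 + e)) ^+ 2.
Proof.
move=> a01 fa sq qe; set S := approx_supp a f d.
have [Q Qpsd Qmin] := gram_min S f.
exists (sq_l2norm (f - galg_gram Q)).
  by split; [exists Q | move=> _ [Q' Q'psd <-]; exact: Qmin].
pose p := best_sqrt_approx a d; pose h := galg_eval p f.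
have [sp pbest] := best_sqrt_approxP a01 d.
have pe t : a <= t <= 1 -> `|p.[t] - Num.sqrt t| <= e.
  move: t; apply/(sqrt_dist_le a01); apply: le_trans (pbest q sq) _.
  exact/(sqrt_dist_le a01).
have hS : gsupp h \subset S by exact: (finset.bigcup_sup (@ord_max d)).
apply: le_trans (Qmin _ (rank1_gram_psd S h)) _.
have -> : f - galg_gram (rank1_gram S h) = galg_eval ('X - p * p) f.
  rewrite gram_rank1// galg_star_eval; last by case: fa.
  by rewrite galg_evalB galg_evalX galg_evalM.
apply: (sq_l2norm_eval_le fa) => t t01; rewrite !hornerE.
have t0 : 0 <= t.
  by case/andP: a01 t01 => a0 _ /andP[at_ _]; exact: le_trans at_.
have s1 : Num.sqrt t <= 1.
  by rewrite -sqrtr1 ler_wsqrtr//; case/andP: t01.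
have s0 := sqrtr_ge0 t.
rewrite -[t in t - _]sqr_sqrtr//; have := pe t t01.
move: (Num.sqrt t) p.[t] s0 s1 => s x s0 s1 xs.
have -> : s ^+ 2 - x * x = - ((x - s) * (2 * s + (x - s))) by ring.
rewrite normrN normrM ler_pM// (le_trans (ler_normD _ _))// lerD//.
by rewrite ger0_norm ?mulr_ge0//; lra.
Qed.

(** d x^d is at most the sum of the x^i for i < d, a partial geometric sum. *)
Lemma nat_mul_exp_le (x : R) (d : nat) : 0 <= x < 1 ->
  d%:R * x ^+ d <= (1 - x)^-1.
Proof.
move=> /andP[x0 x1]; have x1' : 0 < 1 - x by rewrite subr_gt0.
rewrite -[leRHS]mul1r ler_pdivlMr//.
apply: (@le_trans _ _ (1 - x ^+ d)); last by rewrite gerBl exprn_ge0.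
rewrite -[leRHS]opprB subrX1 -mulNr opprB [leRHS]mulrC.
rewrite ler_wpM2r ?(ltW x1')//.
rewrite mulr_natl -[d in _ *+ d]card_ord -sumr_const ler_sum// => i _.
apply: ler_wiXn2l => //; [exact: ltW | exact: ltnW].
Qed.

(** Put s = 1 - a and let r be the base on the right, so s < r.  After division
    by r^(2d) / d the squared error still contains d^3 (s/r)^(2d); writing
    x = sqrt (s/r), this is at most (d x^d)^4, which is bounded. *)
Lemma taylor_rate (a : R) : 0 < a < 1 -> exists2 c : R, 0 < c &
  forall d : nat, (0 < d)%N ->
    (d%:R / a ^+ 2 * (1 - a) ^+ d * (2 + d%:R / a ^+ 2 * (1 - a) ^+ d)) ^+ 2 <=
      c / d%:R * ((1 - a ^+ 2) / (1 + a ^+ 2)) ^+ (2 * d).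
Proof.
move=> /andP[a0 a1].
pose s := 1 - a; pose r := (1 - a ^+ 2) / (1 + a ^+ 2).
have s0 : 0 < s by rewrite subr_gt0.
have a2 : 0 < a ^+ 2 by rewrite exprn_gt0.
have a21 : a ^+ 2 < a by rewrite expr2 gtr_pMr.
have r0 : 0 < r by rewrite divr_gt0//; lra.
have sr : s < r by rewrite ltr_pdivlMr /s; nra.
pose x := Num.sqrt (s / r).
have x01 : 0 <= x < 1.
  by rewrite sqrtr_ge0/= -sqrtr1 ltr_sqrt// ltr_pdivrMr// mul1r.
have x2 : x ^+ 2 = s / r by rewrite sqr_sqrtr// divr_ge0 ?ltW.
pose K := (1 - x)^-1; pose B := 2 + (a ^+ 2)^-1 / a.
have K0 : 0 < K by rewrite invr_gt0 subr_gt0; case/andP: x01.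
have B0 : 0 < B by rewrite ltr_wpDr// divr_ge0// ?invr_ge0 ltW.
exists (K ^+ 4 * B ^+ 2 / a ^+ 4) => [|d d0].
  by rewrite divr_gt0 ?mulr_gt0 ?exprn_gt0.
set e := d%:R / a ^+ 2 * (1 - a) ^+ d.
have d1 : 1 <= d%:R :> R by rewrite ler1n.
have e0 : 0 <= e by rewrite mulr_ge0 ?divr_ge0 ?exprn_ge0// ltW.
have eB : 2 + e <= B.
  rewrite lerD2l /e -mulrA mulrCA ler_wpM2l ?invr_ge0 ?(ltW a2)//.
  have := @nat_mul_exp_le s d; rewrite /s opprB addrCA subrr addr0; apply.
  by rewrite -/s (ltW s0)/= /s gtrBl.
have es : e ^+ 2 = d%:R ^+ 3 * x ^+ (4 * d) / (a ^+ 4 * d%:R) * r ^+ (2 * d).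
  have -> : x ^+ (4 * d) = s ^+ (2 * d) / r ^+ (2 * d).
    have e4 : (4 * d = 2 * (2 * d))%N by rewrite mulnA.
    by rewrite e4 exprM x2 expr_div_n.
  have T0 : r ^+ (2 * d) != 0 by rewrite expf_neq0// gt_eqF.
  have d0' : d%:R != 0 :> R by rewrite pnatr_eq0 -lt0n.
  have a0' : a != 0 by rewrite gt_eqF.
  have -> : s ^+ (2 * d) = (s ^+ d) ^+ 2 by rewrite mulnC exprM.
  rewrite /e -/s; move: (s ^+ d) (r ^+ (2 * d)) T0 (d%:R) d0' => u v v0 w w0.
  by field; rewrite v0 w0 a0'.
have dx : d%:R ^+ 3 * x ^+ (4 * d) <= K ^+ 4.
  apply: (@le_trans _ _ ((d%:R * x ^+ d) ^+ 4)).
    rewrite exprMn -exprM mulnC ler_wpM2r ?exprn_ge0 ?sqrtr_ge0//.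
    by rewrite [leRHS]exprS ler_peMl ?exprn_ge0//; lra.
  rewrite lerXn2r ?nnegrE ?nat_mul_exp_le// ?(ltW K0)//.
  by rewrite mulr_ge0 ?exprn_ge0 ?sqrtr_ge0//; lra.
rewrite exprMn -/r.
apply: (@le_trans _ _ (e ^+ 2 * B ^+ 2)).
  by rewrite ler_wpM2l ?exprn_ge0// lerXn2r ?nnegrE ?(ltW B0)//; lra.
have -> : K ^+ 4 * B ^+ 2 / a ^+ 4 / d%:R * r ^+ (2 * d) =
  (K ^+ 4 / (a ^+ 4 * d%:R) * r ^+ (2 * d)) * B ^+ 2.
  rewrite [(a ^+ 4 * _)^-1]invfM.
  by move: (K ^+ 4) (B ^+ 2) (a ^+ 4)^-1 (d%:R^-1) (r ^+ _) => *; ring.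
rewrite es ler_wpM2r ?exprn_ge0 ?(ltW B0)// ler_wpM2r ?exprn_ge0 ?(ltW r0)//.
rewrite ler_wpM2r// invr_ge0 mulr_ge0 ?exprn_ge0 ?(ltW a0)//; lra.
Qed.

End SosError.

Theorem theorem5p8 (R : realType) (alpha : R) (halpha : 0 <= alpha < 1) :
  exists2 c : R, 0 < c &
    forall (gT : finGroupType) (f : galg R[i] gT) (d : nat),
      spectrum_in alpha f -> (0 < d)%N ->
      exists2 rho : R, is_min (sos_errors alpha f d) rho &
        rho <= (if 0 < alpha
                then c / d%:R * ((1 - alpha ^+ 2) / (1 + alpha ^+ 2)) ^+ (2 * d)
                else c / d%:R ^+ 2).
Proof.
have /andP[a0 a1] := halpha.
have [apos|anpos] := boolP (0 < alpha).
  have [|c c0 rate] := @taylor_rate R alpha; first by rewrite apos.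
  exists c => // gT f d fa d0.
  have [|rho rho_min rho_le] := sos_error_le halpha fa (size_sqrt_taylor R d)
    (e := d%:R / alpha ^+ 2 * (1 - alpha) ^+ d).
    by move=> t t01; exact: sqrt_taylor_error.
  by exists rho => //; apply: le_trans rho_le (rate d d0).
have a00 : alpha = 0 by apply/le_anti; rewrite a0 leNgt anpos.
rewrite a00 in halpha *.
exists 16 => // gT f d fa d0.
have [|rho rho_min rho_le] := sos_error_le halpha fa (size_sqrt_fejer R d)
    (e := 9 / 8 / d%:R).
  by move=> t t01; exact: sqrt_fejer_error.
exists rho => //; apply: le_trans rho_le _.
have d1 : 1 <= d%:R :> R by rewrite ler1n.
(* With i = 1/d <= 1 the bound reads 9/8 i (2 + 9/8 i) <= 4 i. *)
rewrite -mulrA mulrC -exprVn -[16](_ : 4 ^+ 2 = _); last by rewrite -natrX.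
have i0 : 0 <= d%:R^-1 :> R by rewrite invr_ge0; lra.
have i1 : d%:R^-1 <= 1 :> R by rewrite invf_le1; lra.
rewrite -exprMn lerXn2r// ?nnegrE; move: (d%:R^-1) i0 i1 => i i0 i1; nra.
Qed.
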